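(* Assume $p\in[1,\infty)$. Then $$\left(\int_0^\infty e^{-\delta t}|u(t)-u(0)|^pdt\right)^{1/p}\le\frac p\delta\left(\int_0^\infty e^{-\delta t}|\dot u(t)|^pdt\right)^{1/p}$$ for all $\delta>0$ and all $u\in AC_{\mathrm{loc}}([0,\infty);\mathbb R)$.
   Context: $AC_{\mathrm{loc}}([0,\infty);\mathbb R)$ is the set of locally absolutely continuous functions $u:[0,\infty)\to\mathbb R$. The right-hand side may be $+\infty$. *)

(* Defs.v *)
From HB Require Import structures.
From mathcomp Require Import all_boot all_order all_algebra.
From mathcomp Require Import all_classical all_reals all_analysis.
Set Implicit Arguments.
Unset Strict Implicit.
Unset Printing Implicit Defensive.
Import Order.TTheory GRing.Theory Num.Theory.
Import numFieldNormedType.Exports.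
Local Open Scope classical_set_scope.
Local Open Scope ring_scope.

(* Intervals of the family are non-overlapping: only their interiors are
   required to be disjoint, so that adjacent closed intervals are allowed. *)
Definition absolutely_continuous_on (R : realType) (a b : R) (f : R -> R)
    : Prop :=
  forall e : R, 0 < e -> exists2 d : R, 0 < d &
    forall (n : nat) (x y : 'I_n -> R),
      (forall i, [/\ a <= x i, x i <= y i & y i <= b]) ->
      trivIset [set: 'I_n] (fun i => `]x i, y i[%classic) ->
      \sum_(i < n) (y i - x i) < d ->
      \sum_(i < n) `|f (y i) - f (x i)| < e.

(* A function [0, +oo[ -> R is represented by any extension R -> R; the values
   on ]-oo, 0[ are not constrained. *)
Definition AC_loc (R : realType) (u : R -> R) : Prop :=
  forall a b : R, 0 <= a -> a <= b -> absolutely_continuous_on a b u.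

(* Main.v *)
Require Import Defs.
From HB Require Import structures.
From mathcomp Require Import all_boot all_order all_algebra.
From mathcomp Require Import all_classical all_reals all_analysis.
From mathcomp Require Import measurable_realfun ring lra.
Import Order.TTheory GRing.Theory Num.Theory.
Import numFieldNormedType.Exports.
Local Open Scope classical_set_scope.
Local Open Scope ring_scope.

(** Let [v t = `|u t - u 0|]. An absolutely continuous function is the integral of
its derivative, so [v t] is at most the integral of [`|u'|] over [0, t], and the
theorem is an inequality of Hardy type for the exponential weight. Put
[b = delta / p]. Hoelder's inequality with the weight [expR (b * s)] gives

  [v t `^ p <= (expR (b * t) / b) `^ (p - 1) *
               \int_(s in [0, t]) expR (- b * (p - 1) * s) * `|u' s| `^ p];

after multiplication by [expR (- delta * t)] and integration over [t], Tonelli's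
theorem and the integral of [expR (- b * t)] over [s, +oo[ turn the right-hand
side into [(p / delta) `^ p] times the weighted integral of [`|u'| `^ p]. This is
[hardy_expR], and the choice of [b] is what produces the constant [p / delta].

The deeper part is the fundamental theorem of calculus [ac_seq_FTC]. The variation
of an absolutely continuous function is itself absolutely continuous
([ac_seq_total_variation]), hence the function is a difference of two
nondecreasing absolutely continuous ones ([ac_seq_jordan]). The Lebesgue-Stieltjes
measure of each of them vanishes on Lebesgue null sets
([ac_seq_null_dominates]): such a set lies in an open set of small measure, which
is exhausted by finite unions of grid cells. The Radon-Nikodym theorem then
provides densities, and Lebesgue's differentiation theorem identifies their
difference with the derivative almost everywhere.

The density is only available on segments [0, T]; the inequality is proved for the
integral over [0, T] on the left, and [T] tends to infinity. *)

(** * Absolute continuity along lists of intervals *)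

Definition nonoverlapping {R : realType} (I J : R * R) : bool :=
  (I.2 <= J.1) || (J.2 <= I.1).

Definition itv_family {R : realType} (a b : R) (s : seq (R * R)) : bool :=
  all (fun I => [&& a <= I.1, I.1 <= I.2 & I.2 <= b]) s &&
  pairwise (nonoverlapping) s.

(** Absolute continuity over lists of pairs of endpoints rather than families
indexed by ordinals, because the intervals of a list are easily subdivided. *)
Definition ac_seq {R : realType} (a b : R) (f : R -> R) : Prop :=
  forall e : R, 0 < e -> exists2 d : R, 0 < d &
    forall s, itv_family a b s ->
      \sum_(I <- s) (I.2 - I.1) < d ->
      \sum_(I <- s) `|f I.2 - f I.1| < e.

Lemma absolutely_continuous_ac_seq {R : realType} (a b : R) (f : R -> R) :
  absolutely_continuous_on a b f -> ac_seq a b f.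
Proof.
move=> acf e /acf[d d0 H]; exists d => // s /andP[/allP sab sno] sd.
have := H (size s) (fun i => (nth (0, 0) s i).1) (fun i => (nth (0, 0) s i).2).
rewrite !(big_nth (0, 0)) !big_mkord in sd *.
apply => //.
- by move=> i; apply/and3P/sab/mem_nth.
- have disj (i j : 'I_(size s)) : (i < j)%N ->
      `](nth (0, 0) s i).1, (nth (0, 0) s i).2[ `&`
      `](nth (0, 0) s j).1, (nth (0, 0) s j).2[ = set0 :> set R.
    move=> ij; have := pairwiseP (0, 0) sno i j (ltn_ord i) (ltn_ord j) ij.
    rewrite -subset0 => no x []/=; rewrite !in_itv/= => /andP[x1 x2] /andP[x3 x4].
    by case/orP: no => no; [have := lt_trans x3 x2|have := lt_trans x1 x4];
      rewrite ltNge no.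
  apply/trivIsetP => i j _ _; rewrite neq_ltn => /orP[] ij; first exact: disj.
  by rewrite setIC; exact: disj.
Qed.

Lemma ac_seqB {R : realType} (a b : R) (f g : R -> R) :
  ac_seq a b f -> ac_seq a b g -> ac_seq a b (f \- g).
Proof.
move=> acf acg e e0; have e20 : 0 < e / 2 by rewrite divr_gt0.
have [d1 d10 H1] := acf _ e20; have [d2 d20 H2] := acg _ e20.
exists (Num.min d1 d2) => [|s sab]; first by rewrite lt_min d10.
rewrite lt_min => /andP[/(H1 _ sab) sd1 /(H2 _ sab) sd2].
rewrite [e]splitr (le_lt_trans _ (ltrD sd1 sd2))// -big_split/= ler_sum// => I _.
have -> : (f \- g) I.2 - (f \- g) I.1 = (f I.2 - f I.1) - (g I.2 - g I.1).
  by rewrite /=; lra.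
exact: ler_normB.
Qed.

Lemma nonoverlapping_sub {R : realType} (I J K : R * R) :
  I.1 <= J.1 -> J.2 <= I.2 ->
  (nonoverlapping I K -> nonoverlapping J K) /\
  (nonoverlapping K I -> nonoverlapping K J).
Proof.
move=> IJ1 IJ2; rewrite /nonoverlapping; split => /orP[] le; apply/orP.
- by left; exact: le_trans le.
- by right; exact: le_trans IJ1.
- by left; exact: le_trans IJ1.
- by right; exact: le_trans le.
Qed.

Lemma itv_partition_family {R : realType} (a b : R) (l : seq R) :
  itv_partition a b l ->
  [/\ itv_family a b (zip (a :: l) l),
      \sum_(I <- zip (a :: l) l) (I.2 - I.1) = b - a &
      forall f, variation a b f l = \sum_(I <- zip (a :: l) l) `|f I.2 - f I.1|].
Proof.
move=> part.
have var f : variation a b f l = \sum_(I <- zip (a :: l) l) `|f I.2 - f I.1|.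
  rewrite variation_zip//; elim: l a part => [|h t IH] a part.
    by rewrite !big_nil.
  by rewrite /= !big_cons /= IH//; exact: itv_partition_cons part.
split => // {var}; elim: l a part => [|h t IH] a part; rewrite /itv_family/=.
- by [].
- have [/andP[ah _] _] := part.
  have part' := itv_partition_cons part.
  have hb := itv_partition_le part'.
  have /andP[/allP tab tno] := IH _ part'.
  rewrite lexx (ltW ah) hb/= tno andbT.
  apply/andP; split; apply/allP => I /tab /and3P[hI ? ?].
    by apply/and3P; split => //; exact: le_trans (ltW ah) hI.
  by rewrite /nonoverlapping /= hI.
- by rewrite big_nil (itv_partition_nil part) subrr.
- by rewrite /= big_cons IH//=; [lra|exact: itv_partition_cons part].
Qed.

(** Absolute continuity bounds not only the increments of [f] over a short
family but also its variations: refining one interval of the family at a time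
by a partition changes neither its total length nor its disjointness. *)
Lemma ac_seq_total_variation {R : realType} (a b : R) (f : R -> R) :
  ac_seq a b f -> forall e : R, 0 < e -> exists2 d : R, 0 < d &
    forall s, itv_family a b s -> \sum_(I <- s) (I.2 - I.1) < d ->
      (\sum_(I <- s) total_variation I.1 I.2 f <= e%:E)%E.
Proof.
move=> acf e /acf[d d0 H]; exists d => // s.
(* [s1] collects the intervals already subdivided, on which increments are kept. *)
suff main (s1 : seq (R * R)) : itv_family a b (s1 ++ s) ->
    \sum_(I <- s1 ++ s) (I.2 - I.1) < d ->
    ((\sum_(I <- s1) `|f I.2 - f I.1|)%:E +
     \sum_(I <- s) total_variation I.1 I.2 f <= e%:E)%E.
  by move=> sab sd; have := main [::] sab sd; rewrite big_nil add0e.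
elim: s s1 => [|I s IH] s1 fam len.
  by rewrite big_nil adde0 lee_fin ltW// H//; rewrite !cats0 in fam len.
move: fam; rewrite /itv_family all_cat pairwise_cat /=.
rewrite allrel_consr => /andP[/and3P[as1 /and3P[aI I12 Ib] as2]].
move=> /and3P[/andP[no1I no12] no1 /andP[noI no2]].
rewrite big_cons.
have rest0 : (0 <= \sum_(J <- s) total_variation J.1 J.2 f)%E.
  rewrite big_seq sume_ge0// => J /(allP as2)/and3P[_ ? _].
  exact: total_variation_ge0.
have restfin : (\sum_(J <- s) total_variation J.1 J.2 f)%E \is a fin_num.
  rewrite ge0_fin_numE// (@le_lt_trans _ _ e%:E) ?ltry//.
  apply: le_trans (IH s1 _ _).
  - by rewrite leeDr// lee_fin sumr_ge0.
  - by rewrite /itv_family all_cat pairwise_cat as1 as2 no12 no1.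
  - apply: le_lt_trans len; rewrite !big_cat/= big_cons lerD2l lerDr.
    by rewrite subr_ge0.
rewrite [X in (_ + X <= _)%E]addeC addeA -leeBrDl; last by rewrite fin_numD restfin.
apply: ge_ereal_sup => _ [_ [l part <-] <-].
rewrite leeBrDl; last by rewrite fin_numD restfin.
have [/andP[/allP pab pno] plen ->] := itv_partition_family _ _ _ part.
rewrite addeAC -EFinD -big_cat/=; apply: IH.
- rewrite /itv_family !all_cat !pairwise_cat allrel_catl.
  rewrite as1 as2 no12 no1 no2 pno /= !andbT.
  apply/and3P; split; apply/allP => J.
  + move=> /pab /and3P[IJ ? JI]; apply/and3P; split => //.
      exact: le_trans IJ.
    exact: le_trans Ib.
  + move=> /pab /and3P[IJ _ JI]; apply/allP => K Ks.
    by apply: (nonoverlapping_sub I J K IJ JI).1; exact: (allP noI).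
  + move=> Js1; apply/allP => K /pab /and3P[IK _ KI].
    by apply: (nonoverlapping_sub I K J IK KI).2; exact: (allP no1I).
- move: len; rewrite !big_cat/= big_cons plen; lra.
Qed.

Lemma ac_seq_bounded_variation {R : realType} (a b : R) (f : R -> R) :
  a <= b -> ac_seq a b f -> bounded_variation a b f.
Proof.
move=> ab /ac_seq_total_variation/(_ 1 ltr01)[d d0 H]; apply/bounded_variationP => //.
(* [n] steps are enough to make each step [h] shorter than [d]. *)
pose n := (Num.truncn ((b - a) / d)).+1; pose h := (b - a) / n%:R.
have n0 : 0 < n%:R :> R by rewrite ltr0n.
have h0 : 0 <= h by rewrite divr_ge0// subr_ge0.
have hd : h < d by rewrite ltr_pdivrMr// mulrC -ltr_pdivrMr// truncnS_gt.
suff main k : (k <= n)%N -> total_variation a (a + h *+ k) f \is a fin_num.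
  have -> : b = a + h *+ n by rewrite -mulr_natr divfK ?gt_eqF//; lra.
  exact: main.
elim: k => [_|k IH kn]; first by rewrite addr0 total_variationxx.
have hkb : a + h *+ k.+1 <= b.
  rewrite -lerBrDl -mulr_natr /h -mulrA ler_piMr ?subr_ge0//.
  by rewrite mulrC ler_pdivrMr// mul1r ler_nat.
have ahk : a <= a + h *+ k by rewrite lerDl mulrn_wge0.
have hkk : a + h *+ k <= a + h *+ k.+1 by rewrite lerD2l mulrSr lerDl.
rewrite (total_variationD f ahk hkk) fin_numD IH/=; last exact: ltnW.
rewrite ge0_fin_numE ?total_variation_ge0//.
have := H [:: (a + h *+ k, a + h *+ k.+1)].
rewrite !big_seq1/= => Hk; apply: le_lt_trans (Hk _ _) (ltry _).
- by rewrite /itv_family/= ahk hkk hkb.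
- by rewrite mulrSr; lra.
Qed.

(** The monotone parts are the variation of [f] from [a] and its difference with
[f]; the increments of the variation are the variations of [f], so that bounding
these over short families makes both parts absolutely continuous. *)
Lemma ac_seq_jordan {R : realType} (a b : R) (f : R -> R) :
  a <= b -> ac_seq a b f -> exists g h : R -> R,
    [/\ {in `[a, b] &, nondecreasing_fun g}, ac_seq a b g,
        {in `[a, b] &, nondecreasing_fun h}, ac_seq a b h & f = g \- h].
Proof.
move=> ab acf; have bvf := ac_seq_bounded_variation a b f ab acf.
pose V x := fine (total_variation a x f).
have Vfin x : a <= x -> x <= b -> total_variation a x f \is a fin_num.
  by move=> ax xb; apply/bounded_variationP => //; exact: bounded_variationl bvf.
have VB x y : a <= x -> x <= y -> y <= b ->
    (V y - V x)%:E = total_variation x y f.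
  move=> ax xy yb; have xb := le_trans xy yb; have ay := le_trans ax xy.
  rewrite EFinB /V !fineK ?Vfin// (total_variationD f ax xy) addeAC.
  by rewrite subee ?Vfin// add0e.
have normB x y : a <= x -> x <= y -> y <= b -> `|f y - f x| <= V y - V x.
  by move=> ax xy yb; rewrite -lee_fin VB// total_variation_ge.
have ndV : {in `[a, b] &, nondecreasing_fun V}.
  move=> x y; rewrite !in_itv/= => /andP[ax _] /andP[_ yb] xy.
  by rewrite -subr_ge0 (le_trans _ (normB _ _ ax xy yb)).
have acV : ac_seq a b V.
  move=> e e0; have [d d0 H] := ac_seq_total_variation a b f acf _ (divr_gt0 e0 (ltr0Sn _ 1)).
  exists d => // s fam sd; rewrite (@le_lt_trans _ _ (e / 2))//; last lra.
  rewrite -lee_fin (le_trans _ (H s fam sd))// -sumEFin.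
  case/andP: fam => /allP sab _; rewrite [leLHS]big_seq [leRHS]big_seq.
  apply: lee_sum => I /sab/and3P[aI I12 Ib].
  by rewrite -VB// ger0_norm// subr_ge0 ndV// in_itv/= ?aI ?Ib ?andbT// ?(le_trans aI)// (le_trans I12).
exists V, (V \- f); split => //.
- move=> x y; rewrite !in_itv/= => /andP[ax _] /andP[_ yb] xy.
  have := le_trans (ler_norm _) (normB _ _ ax xy yb); lra.
- exact: ac_seqB.
- by apply/funext => x /=; lra.
Qed.

(** * Densities of absolutely continuous functions *)

Lemma lebesgue_stieltjes_itvoc {R : realType} (G : cumulative R R) (x y : R) :
  x <= y -> lebesgue_stieltjes_measure G `]x, y]%classic = (G y - G x)%:E.
Proof.
move=> xy; rewrite /lebesgue_stieltjes_measure/= /measure_extension.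
rewrite measurable_mu_extE/=; last exact: is_ocitv.
by rewrite wlength_itv_bnd.
Qed.

(** The cells of finer and finer uniform grids exhaust an open set by finite
disjoint unions of intervals, to which absolute continuity applies directly;
this replaces the decomposition of the open set into its components. *)
Section grid.
Context {R : realType}.
Variables (a b : R) (U : set R).
Hypothesis ab : a < b.

Definition grid_point (n k : nat) : R := a + (b - a) / n.+1%:R *+ k.

Definition grid_cell (n k : nat) : set R :=
  `]grid_point n k, grid_point n k.+1].

Definition grid_inside (n k : nat) : bool := `[< grid_cell n k `<=` U >].

Definition grid_union (n : nat) : set R :=
  \big[setU/set0]_(k < n.+1 | grid_inside n k) grid_cell n k.

Let step_gt0 (n : nat) : 0 < (b - a) / n.+1%:R.
Proof. by rewrite divr_gt0 ?subr_gt0// ltr0n. Qed.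

Lemma grid_point_le (n j k : nat) : (j <= k)%N ->
  grid_point n j <= grid_point n k.
Proof. by move=> jk; rewrite lerD2l ler_wpMn2l// ltW. Qed.

Lemma grid_point0 (n : nat) : grid_point n 0 = a.
Proof. exact: addr0. Qed.

Lemma grid_pointn (n : nat) : grid_point n n.+1 = b.
Proof. by rewrite /grid_point -mulr_natr divfK ?pnatr_eq0//; lra. Qed.

Lemma grid_unionP (n : nat) (x : R) : grid_union n x <->
  exists k, [/\ (k < n.+1)%N, grid_inside n k & grid_cell n k x].
Proof.
rewrite /grid_union -(bigcup_pred [pred k : 'I_n.+1 | grid_inside n k]).
split => [[k /= ? ?]|[k [kn ? ?]]]; first by exists k.
by exists (Ordinal kn).
Qed.

Lemma grid_union_subset (n : nat) : grid_union n `<=` U.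
Proof.
by move=> x /grid_unionP[k [_ /asboolP kU /kU]].
Qed.

Lemma measurable_grid_union (n : nat) : measurable (grid_union n).
Proof. by apply: bigsetU_measurable => k _; exact: measurable_itv. Qed.

Lemma measure_grid_union (m : {measure set (measurableTypeR R) -> \bar R})
    (n : nat) :
  m (grid_union n) = (\sum_(k < n.+1 | grid_inside n k) m (grid_cell n k))%E.
Proof.
rewrite measure_bigsetU_ord//; first by move=> k; exact: measurable_itv.
have disj (i j : nat) : (i < j)%N -> grid_cell n i `&` grid_cell n j = set0.
  move=> ij; rewrite -subset0 => x []; rewrite /grid_cell/= !in_itv/=.
  move=> /andP[_ x1] /andP[x2 _].
  have := le_lt_trans (le_trans x1 (grid_point_le n _ _ ij)) x2.
  by rewrite ltxx.
apply/trivIsetP => i j _ _; rewrite neq_ltn => /orP[] ij; first exact: disj.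
by rewrite setIC; exact: disj.
Qed.

Lemma grid_union_near (x : R) : open U -> U x -> a < x <= b ->
  \forall n \near \oo, grid_union n x.
Proof.
move=> oU Ux /andP[ax xb].
have [r /= r0 xrU] := open_subball oU Ux.
have r20 : 0 < r / 2 by rewrite divr_gt0.
near=> n.
have hn : (b - a) / n.+1%:R < r / 2.
  rewrite ltr_pdivrMr ?ltr0n// mulrC -ltr_pdivrMr//.
  apply: (@lt_trans _ _ n%:R); last by rewrite ltr_nat.
  by near: n; exact: nbhs_infty_gtr.
have exk : exists k, x <= grid_point n k by exists n.+1; rewrite grid_pointn.
case: (ex_minnP exk) => -[|k] xk kmin.
  by move: xk; rewrite grid_point0 leNgt ax.
have kx : grid_point n k < x.
  by rewrite ltNge; apply/negP => /kmin; rewrite ltnn.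
have kn : (k < n.+1)%N.
  by apply: kmin; rewrite grid_pointn.
apply/grid_unionP; exists k; split => //.
- apply/asboolP => y; rewrite /grid_cell/= in_itv/= => /andP[ky yk].
  apply: (xrU (r / 2)) => //=.
  + by rewrite sub0r normrN gtr0_norm// ltr_pdivrMr// ltr_pMr// ltr1n.
  + have kk : grid_point n k.+1 = grid_point n k + (b - a) / n.+1%:R.
      by rewrite /grid_point mulrSr addrA.
    rewrite /ball/= ltr_norml; apply/andP; move: yk xk; rewrite kk.
    move: hn kx ky; move: (grid_point n k) (_ / _) (r / 2) => *.
    split; lra.
- by rewrite /grid_cell/= in_itv/= kx.
Unshelve. all: by end_near. Qed.

(** The grid unions need not be nested, but every point of [U] in ]a, b] belongs
to all but finitely many of them: the increasing intersections of their tails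
cover, and the measure is continuous along them. *)
Lemma measure_grid_union_le (m : {measure set (measurableTypeR R) -> \bar R})
    (c : \bar R) : open U -> (forall n, (m (grid_union n) <= c)%E) ->
  (m (U `&` `]a, b]) <= c)%E.
Proof.
move=> oU mc.
pose D n := \bigcap_(k in [set k | (n <= k)%N]) grid_union k.
have mD n : measurable (D n).
  by apply: bigcap_measurable => [|k _]; [exists n => /=|exact: measurable_grid_union].
have mUD : measurable (\bigcup_n D n) by exact: bigcup_measurable.
have ndD : nondecreasing_seq D.
  move=> i j ij; apply/subsetPset => x Dx k /= jk; apply: Dx => /=.
  exact: leq_trans jk.
have UD : U `&` `]a, b] `<=` \bigcup_n D n.
  move=> x [Ux]; rewrite /= in_itv/= => xab.
  by have [n _ nx] := grid_union_near x oU Ux xab; exists n.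
apply: (@le_trans _ _ (m (\bigcup_n D n))).
  rewrite le_measure ?inE//; apply: measurableI; last exact: measurable_itv.
  exact: open_measurable.
have cvgD := nondecreasing_cvg_mu (mu := m) mD mUD ndD.
rewrite -(cvg_lim _ cvgD)//; apply: lime_le; first by apply/cvg_ex; eexists; exact: cvgD.
apply: nearW => n; apply: le_trans (mc n).
rewrite /= le_measure ?inE//.
- exact: mD.
- exact: measurable_grid_union.
- by move=> x Dx; apply: Dx => /=.
Qed.

End grid.

Lemma grid_union_increments {R : realType} (a b : R) (U : set R) (n : nat)
    (G : cumulative R R) : a < b ->
  lebesgue_stieltjes_measure G (grid_union a b U n) =
  (\sum_(I <- [seq (grid_point a b n k, grid_point a b n k.+1) |
     k <- iota 0 n.+1 & grid_inside a b U n k]) (G I.2 - G I.1))%:E.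
Proof.
move=> ab; rewrite measure_grid_union// -sumEFin big_map big_filter.
rewrite -(big_mkord (grid_inside a b U n)
  (fun k => lebesgue_stieltjes_measure G (grid_cell a b n k))).
rewrite /index_iota subn0; apply: eq_bigr => k _.
by rewrite lebesgue_stieltjes_itvoc// grid_point_le.
Qed.

Lemma grid_itv_family {R : realType} (a b : R) (U : set R) (n : nat) : a < b ->
  itv_family a b [seq (grid_point a b n k, grid_point a b n k.+1) |
     k <- iota 0 n.+1 & grid_inside a b U n k].
Proof.
move=> ab; apply/andP; split.
  apply/allP => I /mapP[k]; rewrite mem_filter mem_iota add0n => /andP[_ kn] ->/=.
  have p0 := grid_point_le a b ab n 0 k (leq0n k).
  have pn := grid_point_le a b ab n k.+1 n.+1 kn.
  by rewrite grid_point0 in p0; rewrite grid_pointn in pn; rewrite p0 pn grid_point_le.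
rewrite pairwise_map; apply: (@sub_pairwise _ ltn).
  by move=> i j ij; rewrite /nonoverlapping/= grid_point_le.
rewrite -sorted_pairwise; last exact: ltn_trans.
by apply: sorted_filter; [exact: ltn_trans|exact: iota_ltn_sorted].
Qed.

(** A Lebesgue null set is covered by an open set of small measure, whose grid
unions are short families of intervals; absolute continuity makes the
increments of [G] over them small. *)
Lemma ac_seq_null_dominates {R : realType} (a b : R) (G : cumulative R R)
    (A : set R) : a < b -> ac_seq a b G -> measurable A ->
  lebesgue_measure A = 0%E ->
  lebesgue_stieltjes_measure G (A `&` `]a, b]) = 0%E.
Proof.
move=> ab acG mA A0; apply/eqP; rewrite eq_le measure_ge0 andbT.
apply/lee_addgt0Pr => e /acG[d d0 H]; rewrite add0e.
have [|U [oU AU UA]] := lebesgue_regularity_outer mA _ d0; first by rewrite [ltLHS]A0 ltry.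
have mU : measurable U by exact: open_measurable.
have Ud : (lebesgue_measure U < d%:E)%E.
  rewrite -(setDUK AU) measureU//; last 2 first.
  - exact: measurableD.
  - by rewrite setIC setDKI.
  by rewrite [X in (X + _ < _)%E]A0 add0e.
apply: (@le_trans _ _ (lebesgue_stieltjes_measure G (U `&` `]a, b]))).
  rewrite le_measure ?inE//; last exact: setSI.
  - by apply: measurableI => //; exact: measurable_itv.
  - by apply: measurableI => //; exact: measurable_itv.
apply: measure_grid_union_le => // n.
rewrite [leLHS](grid_union_increments a b U n G ab) lee_fin.
under eq_big_seq => I.
  move=> /(allP (andP (grid_itv_family a b U n ab)).1) /and3P[aI I12 Ib].
  rewrite -[_ - _]ger0_norm; first over.
  by rewrite subr_ge0 (cumulative_is_nondecreasing G).
apply/ltW/H; first exact: grid_itv_family.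
rewrite -lte_fin; have <- := grid_union_increments a b U n (@idfun R) ab.
apply: le_lt_trans Ud; rewrite le_measure ?inE//.
  exact: measurable_grid_union.
exact: grid_union_subset.
Qed.

(** A Lebesgue-Stieltjes measure is built from a function that is monotone and
right-continuous on the whole line, so [g] is frozen outside [a, b]. *)
Lemma nondecreasing_ac_cumulative {R : realType} (a b : R) (g : R -> R) :
  a < b -> {in `[a, b] &, nondecreasing_fun g} -> ac_seq a b g ->
  exists2 G : cumulative R R, {in `[a, b], G =1 g} & ac_seq a b G.
Proof.
move=> ab ndg acg; pose c (x : R) := Num.max a (Num.min x b).
have c_in x : c x \in `[a, b].
  by rewrite in_itv/= /c le_max lexx/= ge_max ltW//= ge_min lexx orbT.
have cE x : x \in `[a, b] -> c x = x.
  by rewrite in_itv/= => /andP[ax xb]; rewrite /c min_l// max_r.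
have c_lip x y : x <= y -> 0 <= c y - c x <= y - x.
  move=> xy; rewrite /c.
  case: (leP x b) => ?; case: (leP y b) => ?; rewrite ?(max_r (ltW ab));
    case: (leP a x) => ?; case: (leP a y) => ?; apply/andP; split; lra.
have nd : nondecreasing (g \o c).
  move=> x y xy; apply: ndg => //.
  by have /andP[+ _] := c_lip _ _ xy; rewrite subr_ge0.
have rc : right_continuous (g \o c).
  move=> x; apply/cvgrPdist_lt => e /acg[d d0 H]; near=> y.
  have xy : x <= y by apply: ltW; near: y; exact: nbhs_right_gt.
  have yd : y < x + d by near: y; apply: nbhs_right_lt; rewrite ltrDl.
  have /andP[c0 cd] := c_lip _ _ xy.
  have := H [:: (c x, c y)]; rewrite !big_seq1/= distrC; apply.
    have := c_in x; have := c_in y; rewrite !in_itv/= => /andP[_ cyb] /andP[acx _].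
    by rewrite /itv_family/= acx cyb -subr_ge0 c0.
  lra.
pose G : cumulative R R := HB.pack (g \o c) (isCumulative.Build R _ R (g \o c) nd rc).
have GE : {in `[a, b], G =1 g} by move=> x xab; rewrite /G/= cE.
exists G => // e /acg[d d0 H]; exists d => // s sab /(H s sab) /(le_lt_trans _); apply.
case/andP: sab => /allP sab _; rewrite le_eqVlt; apply/orP; left; apply/eqP.
apply: eq_big_seq => I /sab/and3P[aI I12 Ib].
have I1 : I.1 \in `[a, b] by rewrite in_itv/= aI (le_trans I12).
have I2 : I.2 \in `[a, b] by rewrite in_itv/= Ib (le_trans aI).
by rewrite !GE.
Unshelve. all: by end_near. Qed.

(** The density is the Radon-Nikodym derivative of the Lebesgue-Stieltjes measure
of [g], restricted to ]a, b] to be finite. *)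
Lemma nondecreasing_ac_density {R : realType} (a b : R) (g : R -> R) :
  a < b -> {in `[a, b] &, nondecreasing_fun g} -> ac_seq a b g ->
  exists2 w : R -> R, lebesgue_measure.-integrable setT (EFin \o w) &
    {in `[a, b], forall t, g t - g a = \int[lebesgue_measure]_(x in `]a, t]) w x}.
Proof.
move=> ab ndg acg.
have [G GE acG] := nondecreasing_ac_cumulative a b g ab ndg acg.
pose nu := lebesgue_stieltjes_measure G.
have mab : measurable (`]a, b]%classic : set (measurableTypeR R)).
  exact: measurable_itv.
have nuab : (nu `]a, b]%classic < +oo)%E.
  by rewrite /nu lebesgue_stieltjes_itvoc ?ltry// ltW.
have dom : mfrestr mab nuab `<< @lebesgue_measure R.
  apply/null_content_dominatesP => A mA A0.
  exact: ac_seq_null_dominates.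
have [w [w0 wfin wint wE]] := radon_nikodym_sigma_finite dom.
exists (fine \o w).
  by apply: eq_integrable wint => // x _; rewrite /= fineK.
move=> t tab; move: (tab); rewrite in_itv/= => /andP[at_ tb].
rewrite /Rintegral (eq_integral w); last by move=> x _; rewrite /= fineK.
have tab' : `]a, t] `<=` `]a, b].
  by move=> x /=; rewrite !in_itv/= => /andP[-> xt]; exact: le_trans tb.
have <- : nu `]a, t]%classic = (\int[lebesgue_measure]_(x in `]a, t]) w x)%E.
  rewrite -wE; last exact: measurable_itv.
  by rewrite -[in LHS](setIidl tab').
by rewrite /nu lebesgue_stieltjes_itvoc// !GE// in_itv/= lexx ltW.
Qed.

Lemma ac_seq_density {R : realType} (a b : R) (f : R -> R) :
  a < b -> ac_seq a b f ->
  exists2 w : R -> R, lebesgue_measure.-integrable setT (EFin \o w) &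
    {in `[a, b], forall t, f t - f a = \int[lebesgue_measure]_(x in `]a, t]) w x}.
Proof.
move=> ab acf.
have [g [h [ndg acg ndh ach ->]]] := ac_seq_jordan a b f (ltW ab) acf.
have [v vint vE] := nondecreasing_ac_density a b g ab ndg acg.
have [w wint wE] := nondecreasing_ac_density a b h ab ndh ach.
exists (v \- w) => [|t tab].
  by apply: eq_integrable (integrableB measurableT vint wint).
rewrite RintegralB//; last 2 first.
- by apply: integrableS vint.
- by apply: integrableS wint.
by rewrite -vE// -wE//=; lra.
Qed.

(** Almost every point is a Lebesgue point of the density, and there the
derivative of its integral, hence of [f], is the density. *)
Theorem ac_seq_FTC {R : realType} (a b : R) (f : R -> R) :
  a < b -> ac_seq a b f ->
  exists w : R -> R, [/\ lebesgue_measure.-integrable setT (EFin \o w),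
    {in `[a, b], forall t, f t - f a = \int[lebesgue_measure]_(x in `]a, t]) w x} &
    {ae @lebesgue_measure R, forall x, x \in `]a, b[ -> derive1 f x = w x}].
Proof.
move=> ab /(ac_seq_density a b f ab)[w wint wE]; exists w; split => //.
have locw : locally_integrable setT w by apply: open_integrable_locally => //; exact: openT.
have := lebesgue_differentiation locw.
apply: filterS; first exact: (ae_filter_ringOfSetsType lebesgue_measure).
move=> x wx xab.
have /andP[ax xb] : a < x < b by rewrite in_itv/= in xab.
have intw : lebesgue_measure.-integrable [set` Interval (BRight a) (BRight b)] (EFin \o w).
  exact: integrableS wint.
have axB : (BRight a < BRight x)%O by rewrite bnd_simp.
have [dF FE] := FTC1_lebesgue_pt xb intw axB wx.
pose F y := \int[lebesgue_measure]_(t in `]a, y]) w t.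
have fF : \forall y \near x, f y = (F \+ cst (f a)) y.
  near=> y; have yab : y \in `]a, b[.
    by near: y; exact: near_in_itvoo.
  by rewrite /= /F -wE ?subrK//; move: yab; rewrite !in_itv/= => /andP[/ltW -> /ltW].
rewrite derive1E (near_eq_derive _ fF) deriveD// derive_cst addr0.
by rewrite -FE derive1E.
Unshelve. all: by end_near. Qed.

(** * A weighted Hardy inequality *)

Lemma is_derive_expR_scale {R : realType} (c x : R) : c != 0 ->
  is_derive x (1 : R) (fun s => expR (c * s) / c) (expR (c * x)).
Proof.
move=> c0.
have dc : is_derive x (1 : R) (fun s : R => c * s) c.
  by have := is_deriveZ c (is_derive_id x (1 : R)); rewrite [_ *: 1]mulr1.
have de := is_derive1_comp (is_derive_expR (c * x)) dc.
have := is_deriveZ c^-1 de.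
rewrite [c^-1 *: _]mulrCA mulVf// mulr1.
by apply: near_eq_is_derive; near=> y; rewrite /= [_ *: _]mulrC.
Unshelve. all: by end_near. Qed.

Lemma continuous_expR_scale {R : realType} (c : R) :
  continuous (fun s : R => expR (c * s)).
Proof.
move=> x; apply: continuous_comp; last exact: continuous_expR.
exact: mulrl_continuous.
Qed.

Lemma integral_expR_le {R : realType} (b t : R) : 0 < b -> 0 <= t ->
  (\int[@lebesgue_measure R]_(s in `[0%R, t]) (expR (b * s))%:E <=
   (expR (b * t) / b)%:E)%E.
Proof.
move=> b0; have bn0 : b != 0 by rewrite gt_eqF.
rewrite le_eqVlt => /predU1P[<-|t0].
  by rewrite set_itv1 integral_set1 lee_fin divr_ge0 ?expR_ge0 ?ltW.
have cF : continuous (fun s : R => expR (b * s) / b).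
  move=> x; apply: differentiable_continuous; apply/derivable1_diffP.
  by case: (is_derive_expR_scale _ x bn0).
rewrite (@continuous_FTC2 _ _ (fun s => expR (b * s) / b))//.
- by rewrite -EFinB lee_fin lerBlDr lerDl divr_ge0 ?expR_ge0 ?ltW.
- by apply: continuous_subspaceT; exact: continuous_expR_scale.
- split.
  + by move=> x _; case: (is_derive_expR_scale _ x bn0).
  + exact/cvg_at_right_filter/cF.
  + exact/cvg_at_left_filter/cF.
- move=> x _; rewrite derive1E.
  by case: (is_derive_expR_scale _ x bn0).
Qed.

Lemma integral_expR_tail {R : realType} (b s : R) : 0 < b ->
  (\int[@lebesgue_measure R]_(t in `[s, +oo[) (expR (- b * t))%:E =
   (expR (- b * s) / b)%:E)%E.
Proof.
move=> b0; have bn0 : - b != 0 by rewrite oppr_eq0 gt_eqF.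
have cF : continuous (fun s : R => expR (- b * s) / - b).
  move=> x; apply: differentiable_continuous; apply/derivable1_diffP.
  by case: (is_derive_expR_scale _ x bn0).
rewrite (@ge0_continuous_FTC2y _ _ (fun t => expR (- b * t) / - b) _ 0)//.
- by rewrite -EFinB sub0r invrN mulrN opprK.
- by apply: continuous_subspaceT; exact: continuous_expR_scale.
- rewrite -[X in _ --> X](mul0r (- b)^-1); apply: cvgMl.
  rewrite (_ : (fun x => expR (- b * x)) = (fun z => expR (- z)) \o (fun z => b * z)).
    apply: (@cvg_comp _ _ _ _ _ _ (pinfty_nbhs R)); last exact: cvgr_expR.
    exact: gt0_cvgMry.
  by apply/funext => x /=; rewrite mulNr.
- exact/cvg_at_right_filter/cF.
- move=> x _; rewrite derive1E.
  by case: (is_derive_expR_scale _ x bn0).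
Qed.

(** The integral of a nonnegative function is a supremum over the simple
functions below it, hence it is monotone on arbitrary functions. This applies to
the derivative of a function that is differentiable only almost everywhere. *)
Lemma le_ge0_integral d (T : measurableType d) {R : realType}
    (mu : {measure set T -> \bar R}) (D E : set T) (f g : T -> \bar R) :
  D `<=` E -> (forall x, D x -> 0 <= f x)%E -> (forall x, E x -> 0 <= g x)%E ->
  (forall x, D x -> f x <= g x)%E ->
  (\int[mu]_(x in D) f x <= \int[mu]_(x in E) g x)%E.
Proof.
move=> DE f0 g0 fg; rewrite !ge0_integralE//; apply: ge_ereal_sup.
move=> _ [h hf <-]; apply: ereal_sup_ubound; exists h => // x.
apply: le_trans (hf x) _; rewrite !patchE; case: ifPn => [|_].
  by rewrite inE => Dx; rewrite mem_set ?fg//; exact: DE.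
by case: ifPn => //; rewrite inE; exact: g0.
Qed.

(** Hoelder's inequality for the product of [w s * expR (- a * s)] and
[expR (a * s)], with [a] such that the conjugate power of the second factor is
[expR (b * s)], whose integral over [0, t] is at most [expR (b * t) / b]. *)
Lemma holder_expR {R : realType} (p b t : R) (w : R -> R) :
  1 <= p -> 0 < b -> 0 <= t -> measurable_fun setT w -> (forall s, 0 <= w s) ->
  ((\int[@lebesgue_measure R]_(s in `[0%R, t]) (w s)%:E) `^ p <=
   ((expR (b * t) / b) `^ (p - 1))%:E *
   \int[@lebesgue_measure R]_(s in `[0%R, t])
     (expR (- (b * (p - 1)) * s) * w s `^ p)%:E)%E.
Proof.
move=> p1 b0 t0 mw w0; set mu := @lebesgue_measure R; set I := `[0, t]%classic.
have mI : measurable I by exact: measurable_itv.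
(* The conjugate exponent of 1 is infinite; there the inequality is an equality. *)
move: p1; rewrite le_eqVlt => /predU1P[<-|p1].
  rewrite subrr powRr0 mul1e poweRe1; last first.
    by apply: integral_ge0 => s _; rewrite lee_fin.
  by under [leRHS]eq_integral do rewrite mulr0 oppr0 mul0r expR0 mul1r powRr1//.
have p0 : 0 < p by rewrite (lt_trans _ p1).
have p10 : 0 < p - 1 by rewrite subr_gt0.
pose q := p / (p - 1); pose a := b * (p - 1) / p.
have q0 : 0 < q by rewrite divr_gt0.
have pn0 : p != 0 by rewrite gt_eqF.
have qn0 : q != 0 by rewrite gt_eqF.
have p1n0 : p - 1 != 0 by rewrite gt_eqF.
have aq : a * q = b by rewrite /a /q; field; rewrite ?pn0 ?p1n0.
have ap : a * p = b * (p - 1) by rewrite divfK.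
have pq : p^-1 + q^-1 = 1 by rewrite /q invf_div -[X in X + _]mul1r -mulrDl addrC subrK divff.
have mexp (c : R) : measurable_fun setT (fun s : R => expR (c * s)).
  by apply: continuous_measurable_fun; exact: continuous_expR_scale.
pose f := (fun s => w s * expR (- a * s)) \_ I.
pose g := (fun s => expR (a * s)) \_ I.
have mf : measurable_fun setT f.
  apply/(measurable_restrictT _ _).1 => //; apply: measurable_funTS.
  exact: measurable_funM.
have mg : measurable_fun setT g.
  apply/(measurable_restrictT _ _).1 => //; apply: measurable_funTS.
  exact: mexp.
have Nfg : (\int[mu]_(s in I) (w s)%:E)%E = Lnorm mu 1 (EFin \o (f \* g)).
  rewrite Lnorm1 [LHS]integral_mkcond; apply: eq_integral => s _.
  rewrite /= /f /g !patchE; case: ifPn => _; last by rewrite mul0r normr0.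
  by rewrite -mulrA -expRD mulNr addNr expR0 mulr1 ger0_norm.
have Nf : (Lnorm mu p%:E (EFin \o f) `^ p =
    \int[mu]_(s in I) (expR (- (b * (p - 1)) * s) * w s `^ p)%:E)%E.
  rewrite poweR_Lnorm// [RHS]integral_mkcond; apply: eq_integral => s _.
  rewrite /= /f !patchE; case: ifPn => _; last by rewrite normr0 powR0.
  rewrite ger0_norm ?mulr_ge0 ?expR_ge0// powRM ?expR_ge0// mulrC.
  by rewrite -expRM -ap !mulNr mulrAC.
have Ng : (Lnorm mu q%:E (EFin \o g) `^ p <= ((expR (b * t) / b) `^ (p - 1))%:E)%E.
  have pE : p = q * (p - 1) by rewrite divfK.
  rewrite [X in (_ `^ X <= _)%E]pE poweRrM poweR_Lnorm// -poweR_EFin.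
  have gI : (\int[mu]_x `|(EFin \o g) x| `^ q = \int[mu]_(s in I) (expR (b * s))%:E)%E.
    rewrite [RHS]integral_mkcond; apply: eq_integral => s _.
    rewrite /= /g !patchE; case: ifPn => _; last by rewrite normr0 powR0.
    by rewrite ger0_norm ?expR_ge0// -expRM mulrAC aq.
  rewrite gI; apply: gt0_ler_poweR; rewrite ?(ltW p10)//.
  - by rewrite in_itv/= leey andbT integral_ge0// => s _; rewrite lee_fin expR_ge0.
  - by rewrite in_itv/= leey andbT lee_fin divr_ge0 ?expR_ge0 ?ltW.
  - exact: integral_expR_le.
rewrite Nfg -Nf muleC.
apply: (@le_trans _ _ ((Lnorm mu p%:E (EFin \o f) * Lnorm mu q%:E (EFin \o g)) `^ p)%E).
  apply: gt0_ler_poweR; rewrite ?(ltW p0)//.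
  - by rewrite in_itv/= leey andbT Lnorm_ge0.
  - by rewrite in_itv/= leey andbT mule_ge0 ?Lnorm_ge0.
  - exact: hoelder.
by rewrite poweRM ?Lnorm_ge0// lee_wpmul2l ?poweR_ge0.
Qed.

(** With [b = delta / p], [holder_expR] bounds the integrand at [t] by a multiple
of [expR (- b * t)] times an integral over [0, t]; exchanging the integrals, the tail of that exponential restores the
weight [expR (- delta * s)] and the constants multiply up to [(p / delta) `^ p]. *)
Theorem hardy_expR {R : realType} (p delta : R) (w : R -> R) :
  1 <= p -> 0 < delta -> measurable_fun setT w -> (forall s, 0 <= w s) ->
  (\int[@lebesgue_measure R]_(t in `[0%R, +oo[) ((expR (- delta * t))%:E *
     (\int[@lebesgue_measure R]_(s in `[0%R, t]) (w s)%:E) `^ p) <=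
   ((p / delta) `^ p)%:E *
   \int[@lebesgue_measure R]_(s in `[0%R, +oo[)
     (expR (- delta * s) * w s `^ p)%:E)%E.
Proof.
move=> p1 d0 mw w0; set mu := @lebesgue_measure R.
set P : set R := `[0, +oo[%classic.
have mP : measurable P by exact: measurable_itv.
have p0 : 0 < p by rewrite (lt_le_trans _ p1).
have pn0 : p != 0 by rewrite gt_eqF.
pose b := delta / p; have b0 : 0 < b by rewrite divr_gt0.
have bp : b * p = delta by rewrite divfK.
pose k s := expR (- (b * (p - 1)) * s) * w s `^ p.
have k0 s : 0 <= k s by rewrite mulr_ge0 ?expR_ge0 ?powR_ge0.
pose C := b^-1 `^ (p - 1); have C0 : 0 <= C by exact: powR_ge0.
have mexp (c : R) : measurable_fun setT (fun s : R => expR (c * s)).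
  by apply: continuous_measurable_fun; exact: continuous_expR_scale.
have mk : measurable_fun setT k.
  apply: measurable_funM; first exact: mexp.
  exact: (measurableT_comp (measurable_powR p) mw).
pose K (z : measurableTypeR R * measurableTypeR R) : \bar R :=
  (C * expR (- b * z.1) * \1_P (z.1 - z.2) * (k z.2 * \1_P z.2))%:E.
have K0 z : (0 <= K z)%E.
  by rewrite lee_fin !mulr_ge0 ?expR_ge0 ?powR_ge0 ?indicE ?ler0n.
have mK : measurable_fun setT K.
  apply/measurable_EFinP; apply: measurable_funM.
    apply: measurable_funM.
      apply: measurable_funM => //.
      by apply: (measurableT_comp (mexp (- b))); exact: measurable_fst.
    apply: (measurableT_comp (measurable_indic mP)).
    by apply: measurable_funB; [exact: measurable_fst|exact: measurable_snd].
  apply: measurable_funM.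
    by apply: (measurableT_comp mk); exact: measurable_snd.
  by apply: (measurableT_comp (measurable_indic mP)); exact: measurable_snd.
have Pin x : (x \in P) = (0 <= x) by rewrite /P mem_setE in_itv/= andbT.
apply: (@le_trans _ _ (\int[mu]_t \int[mu]_s K (t, s))%E).
  apply: le_ge0_integral => //.
  - by move=> t _; rewrite mule_ge0 ?poweR_ge0// lee_fin expR_ge0.
  - by move=> t _; apply: integral_ge0.
  move=> t; rewrite /P/= in_itv/= andbT => t0.
  have -> : (\int[mu]_s K (t, s) =
      (C * expR (- b * t))%:E * \int[mu]_(s in `[0%R, t]) (k s)%:E)%E.
    rewrite -ge0_integralZl//; last 3 first.
    - by apply/measurable_EFinP; exact: measurable_funTS.
    - by move=> s _; rewrite lee_fin.
    - by rewrite lee_fin mulr_ge0 ?expR_ge0.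
    rewrite [RHS]integral_mkcond; apply: eq_integral => s _.
    rewrite /K/= patchE mem_setE in_itv/= !indicE !Pin subr_ge0.
    case: (leP 0 s) => s0; case: (leP s t) => st //=;
      by rewrite ?mulr1 ?mulr0 ?mul0r// EFinM.
  apply: (@le_trans _ _ ((expR (- delta * t))%:E *
    (((expR (b * t) / b) `^ (p - 1))%:E * \int[mu]_(s in `[0%R, t]) (k s)%:E))%E).
    by rewrite lee_wpmul2l ?lee_fin ?expR_ge0// holder_expR.
  rewrite muleA -EFinM le_eqVlt; apply/orP; left; apply/eqP; congr (_%:E * _)%E.
  rewrite powRM ?expR_ge0 ?invr_ge0 ?(ltW b0)// -expRM mulrA -expRD mulrC.
  by congr (_ * expR _); rewrite -bp; ring.
rewrite (fubini_tonelli K)// -ge0_integralZl//; last 3 first.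
- apply/measurable_EFinP; apply: measurable_funTS; apply: measurable_funM.
    exact: mexp.
  exact: (measurableT_comp (measurable_powR p) mw).
- by move=> s _; rewrite lee_fin mulr_ge0 ?expR_ge0 ?powR_ge0.
- by rewrite lee_fin powR_ge0.
rewrite [leRHS]integral_mkcond le_eqVlt; apply/orP; left; apply/eqP.
apply: eq_integral => s _; rewrite patchE Pin; case: ifPn => s0; last first.
  apply: integral0_eq => t _; rewrite /K/= !indicE !Pin (negbTE s0).
  by rewrite !mulr0.
transitivity (\int[mu]_(t in `[s, +oo[) ((C * k s)%:E * (expR (- b * t))%:E))%E.
  rewrite [RHS]integral_mkcond; apply: eq_integral => t _.
  rewrite /K/= patchE mem_setE in_itv/= andbT !indicE !Pin subr_ge0 s0 mulr1.
  by case: ifPn => _; rewrite ?mulr1 ?mulr0 ?mul0r// -EFinM mulrAC.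
rewrite ge0_integralZl//; last 2 first.
- by apply/measurable_EFinP; apply: measurable_funTS; exact: mexp.
- by rewrite lee_fin mulr_ge0.
rewrite integral_expR_tail// -!EFinM; congr (_%:E).
have -> : (p / delta) `^ p = C / b.
  rewrite [RHS]mulrC mulr_powRB1 ?invr_ge0 ?(ltW b0)//.
  by rewrite /b invf_div.
have -> : expR (- delta * s) = expR (- (b * (p - 1)) * s) * expR (- b * s).
  by rewrite -expRD; congr expR; rewrite -bp; ring.
rewrite /k; ring.
Qed.

(** * The inequality on the half-line *)

Lemma ac_seq_continuous {R : realType} (a b : R) (f : R -> R) :
  ac_seq a b f -> {within `[a, b], continuous f}.
Proof.
move=> acf; apply/subspace_continuousP => x; rewrite /= in_itv/= => /andP[ax xb].
apply/cvgrPdist_lt => e /acf[d d0 H]; near=> y.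
have /andP[ay yb] : a <= y <= b.
  suff : `[a, b]%classic y by rewrite /= in_itv.
  by near: y; exact: withinT.
have : `|x - y| < d by near: y; exact: (cvg_within _ (nbhsx_ballx x d d0)).
case: (leP x y) => [xy|/ltW yx] xyd.
- have := H [:: (x, y)]; rewrite !big_seq1/= distrC; apply.
    by rewrite /itv_family/= ax xy yb.
  by move: xyd; rewrite distrC; apply: le_lt_trans; exact: ler_norm.
- have := H [:: (y, x)]; rewrite !big_seq1/=; apply.
    by rewrite /itv_family/= ay yx xb.
  by move: xyd; apply: le_lt_trans; exact: ler_norm.
Unshelve. all: by end_near. Qed.

(** On a segment the increments of [u] are bounded by integrals of a density that
is almost everywhere its derivative, so that the Hardy inequality applies. *)
Lemma weighted_poincare_segment {R : realType} (p delta T : R) (u : R -> R) :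
  1 <= p -> 0 < delta -> 0 < T -> AC_loc u ->
  (\int[@lebesgue_measure R]_(t in `[0%R, T])
      (expR (- delta * t) * `|u t - u 0| `^ p)%:E <=
   ((p / delta) `^ p)%:E * \int[@lebesgue_measure R]_(t in `[0%R, +oo[)
         (expR (- delta * t) * `|derive1 u t| `^ p)%:E)%E.
Proof.
move=> p1 d0 T0 acu; have p0 : 0 < p by rewrite (lt_le_trans _ p1).
have /absolutely_continuous_ac_seq acT := acu 0 T (lexx _) (ltW T0).
have [w [wint wE [N [mN N0 subN]]]] := ac_seq_FTC 0 T u T0 acT.
have mw : measurable_fun setT w.
  by apply/measurable_EFinP; exact: measurable_int wint.
(* Beyond [T] the density is unrelated to [u], so it is cut off there. *)
pose v := (fun s => `|w s|) \_ `[0, T].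
have v0 s : 0 <= v s by rewrite /v patchE; case: ifPn.
have mv : measurable_fun setT v.
  apply/(measurable_restrictT _ _).1; first exact: measurable_itv.
  by apply: measurable_funTS; exact: measurableT_comp.
have wpow_ge0 (f : R -> R) t : (0 <= (expR (- delta * t) * `|f t| `^ p)%:E)%E.
  by rewrite lee_fin mulr_ge0 ?expR_ge0 ?powR_ge0.
have uv t : 0 <= t -> t <= T ->
    (`|u t - u 0|%:E <= \int[@lebesgue_measure R]_(s in `[0%R, t]) (v s)%:E)%E.
  move=> t0 tT; rewrite wE ?in_itv/= ?t0//.
  have intw : lebesgue_measure.-integrable `]0, t] (EFin \o w).
    by apply: integrableS wint => //; exact: measurable_itv.
  have mt : measurable (`]0, t]%classic : set R) by exact: measurable_itv.
  apply: (@le_trans _ _ (\int[@lebesgue_measure R]_(s in `]0%R, t]) `|w s|%:E)%E).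
    have /integrableP[mwt _] := intw.
    rewrite /Rintegral -abse_EFin fineK; first exact: le_abse_integral.
    exact: integrable_fin_num.
  apply: le_ge0_integral => //.
  - exact: subset_itv_oc_cc.
  - by move=> s _; rewrite lee_fin.
  move=> s; rewrite /= in_itv/= => /andP[s0 st]; rewrite lee_fin /v patchE.
  by rewrite mem_setE in_itv/= (ltW s0) (le_trans st tT).
apply: (@le_trans _ _ (\int[@lebesgue_measure R]_(t in `[0%R, +oo[)
    ((expR (- delta * t))%:E *
      (\int[@lebesgue_measure R]_(s in `[0%R, t]) (v s)%:E) `^ p))%E).
  apply: le_ge0_integral.
  - by move=> t /=; rewrite !in_itv/= andbT => /andP[].
  - by move=> t _.
  - by move=> t _; rewrite mule_ge0 ?poweR_ge0// lee_fin expR_ge0.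
  move=> t /=; rewrite in_itv/= => /andP[t0 tT].
  rewrite EFinM lee_wpmul2l ?lee_fin ?expR_ge0// -poweR_EFin.
  apply: gt0_ler_poweR; rewrite ?(ltW p0)//.
  - by rewrite in_itv/= leey andbT lee_fin.
  - by rewrite in_itv/= leey andbT integral_ge0// => s _; rewrite lee_fin.
  - exact: uv.
apply: le_trans (hardy_expR p delta v p1 d0 mv v0) _.
rewrite lee_wpmul2l ?lee_fin ?powR_ge0//.
(* At the endpoints the two-sided derivative is not determined by [u] on [0, T]. *)
pose N' := N `|` ([set 0] `|` [set T]).
have m0 : measurable ([set 0] : set (measurableTypeR R)) by exact: measurable_set1.
have mT : measurable ([set T] : set (measurableTypeR R)) by exact: measurable_set1.
have m0T := measurableU _ _ m0 mT.
have mN' := measurableU _ _ mN m0T.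
have T0' : @lebesgue_measure R [set T] = 0%E by exact: lebesgue_measure_set1.
have N'0 : @lebesgue_measure R N' = 0%E.
  by rewrite /N' measureU0// measureU0//; exact: lebesgue_measure_set1.
rewrite (ge0_negligible_integral mN')//; last 2 first.
- apply/measurable_EFinP; apply: measurable_funTS; apply: measurable_funM.
    by apply: continuous_measurable_fun; exact: continuous_expR_scale.
  exact: (measurableT_comp (measurable_powR p) mv).
- by move=> s _; rewrite lee_fin mulr_ge0 ?expR_ge0 ?powR_ge0.
apply: le_ge0_integral => //.
- by move=> s _; rewrite lee_fin mulr_ge0 ?expR_ge0 ?powR_ge0.
move=> s [/=]; rewrite in_itv/= andbT => s0 N's.
rewrite lee_fin ler_wpM2l ?expR_ge0// /v patchE mem_setE in_itv/= s0/=.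
case: ifPn => sT; last by rewrite powR0 ?gt_eqF// powR_ge0.
rewrite le_eqVlt; apply/orP; left; apply/eqP; congr (`|_| `^ _).
apply: contrapT => ws; apply: (N's); left; apply: subN => /= H; apply: ws.
rewrite H// in_itv/= !lt_neqAle s0 sT !andbT.
apply/andP; split; apply/eqP => E; apply: (N's); right; first by left.
by right.
Qed.

Lemma weighted_poincare {R : realType} (p delta : R) (u : R -> R) :
  1 <= p -> 0 < delta -> AC_loc u ->
  (\int[@lebesgue_measure R]_(t in `[0%R, +oo[)
      (expR (- delta * t) * `|u t - u 0| `^ p)%:E <=
   ((p / delta) `^ p)%:E * \int[@lebesgue_measure R]_(t in `[0%R, +oo[)
         (expR (- delta * t) * `|derive1 u t| `^ p)%:E)%E.
Proof.
move=> p1 d0 acu; rewrite [X in integral _ X _]itv_bndy_bigcup_BRight.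
have mseg n : measurable (`[0, 0 + n%:R]%classic : set (measurableTypeR R)).
  exact: measurable_itv.
have ndseg : nondecreasing_seq (fun n => `[0, 0 + n%:R]%classic : set R).
  move=> i j ij; apply/subsetPset => x /=; rewrite !in_itv/= => /andP[-> xi].
  by rewrite (le_trans xi)// lerD2l ler_nat.
pose F t := (expR (- delta * t) * `|u t - u 0| `^ p)%:E.
have mF n : measurable_fun (`[0, 0 + n%:R]%classic : set (measurableTypeR R)) F.
  apply/measurable_EFinP; apply: measurable_funM.
    apply: measurable_funTS; apply: continuous_measurable_fun.
    exact: continuous_expR_scale.
  apply: (measurableT_comp (measurable_powR p)); apply: measurableT_comp => //.
  apply: measurable_funB => //; apply: subspace_continuous_measurable_fun => //.
  apply/ac_seq_continuous/absolutely_continuous_ac_seq/acu; first exact: lexx.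
  by rewrite add0r ler0n.
have F0 n t : (`[0, 0 + n%:R]%classic : set R) t -> (0 <= F t)%E.
  by move=> _; rewrite lee_fin mulr_ge0 ?expR_ge0 ?powR_ge0.
have cvgI := @ge0_nondecreasing_set_cvg_integral _ (measurableTypeR R) R _ _
  lebesgue_measure ndseg mseg mF F0.
rewrite -(cvg_lim _ cvgI)//; apply: lime_le.
  by apply/cvg_ex; eexists; exact: cvgI.
near=> n; rewrite add0r; apply: weighted_poincare_segment => //.
by rewrite ltr0n; near: n; exact: nbhs_infty_gt.
Unshelve. all: by end_near. Qed.

(* The two-sided derivative derive1 u at t > 0 only depends on u near t, hence on
   the restriction of u to [0, +oo[; the point t = 0 is negligible. At the
   (negligibly many) points where u is not differentiable, derive1 u is a default
   value. *)
Theorem lemma2p1 (R : realType) (p : R) (hp : 1 <= p) (delta : R)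
    (hdelta : 0 < delta) (u : R -> R) (hu : AC_loc u) :
  ((\int[@lebesgue_measure R]_(t in `[0%R, +oo[)
      (expR (- delta * t) * `|u t - u 0| `^ p)%:E) `^ (p^-1)%R
   <= (p / delta)%:E *
      (\int[@lebesgue_measure R]_(t in `[0%R, +oo[)
         (expR (- delta * t) * `|derive1 u t| `^ p)%:E) `^ (p^-1)%R)%E.
Proof.
have p0 : 0 < p by rewrite (lt_le_trans _ hp).
have pd0 : 0 <= p / delta by rewrite divr_ge0 ?ltW.
have int_ge0 (f : R -> R) :
    (0 <= \int[@lebesgue_measure R]_(t in `[0%R, +oo[)
       (expR (- delta * t) * `|f t| `^ p)%:E)%E.
  by apply: integral_ge0 => t _; rewrite lee_fin mulr_ge0 ?expR_ge0 ?powR_ge0.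
have -> : (p / delta)%:E = (((p / delta) `^ p)%:E `^ p^-1)%E.
  by rewrite poweR_EFin -powRrM divff ?gt_eqF// powRr1.
rewrite -poweRM ?lee_fin ?powR_ge0//; apply: gt0_ler_poweR.
- by rewrite invr_ge0 ltW.
- by rewrite in_itv/= leey andbT (int_ge0 (fun t => u t - u 0)).
- by rewrite in_itv/= leey andbT mule_ge0// lee_fin powR_ge0.
- exact: weighted_poincare.
Qed.
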